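(* Let the problem data, the weights $a_j^i(k)$ and the coefficients $c(k)$ satisfy Assumptions (Convexity), (Compactness), (Slater), (Coefficient), (Weights) and (Connectivity) stated in the context, and let $\hat x(k)=(\hat x_1(k),\dots,\hat x_m(k))$, $k\ge 0$, be generated by the algorithm described in the context. Then $$\lim_{k\to\infty}\operatorname{dist}(\hat x(k),X^\star)=0 .$$
   Context: Notation. $\|\cdot\|$ is the Euclidean norm; $\operatorname{dist}(y,Z)=\min_{z\in Z}\|y-z\|$; $\mathbb{R}^p_+$ is the non-negative orthant of $\mathbb{R}^p$ ($\lambda\ge 0$ means $\lambda\in\mathbb{R}^p_+$); vector inequalities are component-wise; $\operatorname{relint}$ is relative interior. Problem. There are $m$ agents. Agent $i$ has a set $X_i\subseteq\mathbb{R}^{n_i}$ and functions $f_i:\mathbb{R}^{n_i}\to\mathbb{R}$, $g_i:\mathbb{R}^{n_i}\to\mathbb{R}^p$. Let $n=\sum_i n_i$, $X=X_1\times\cdots\times X_m\subseteq\mathbb{R}^n$, $x=(x_1,\dots,x_m)$. The primal problem $\mathcal{P}$ is: minimize $\sum_{i=1}^m f_i(x_i)$ over $x\in X$ subject to $\sum_{i=1}^m g_i(x_i)\le 0$. $X^\star$ denotes the set of all minimizers of $\mathcal{P}$. Algorithm. Take any $\hat x_i(0)\in X_i$ and $\lambda_i(0)\in\mathbb{R}^p_+$, $i=1,\dots,m$. For $k=0,1,2,\dots$ and each $i$: - $\ell_i(k)=\sum_{j=1}^m a_j^i(k)\lambda_j(k)$; - $x_i(k+1)\in\arg\min_{x_i\in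 X_i}\{f_i(x_i)+\ell_i(k)^\top g_i(x_i)\}$ (any minimizer); - $\lambda_i(k+1)=\arg\max_{\lambda_i\ge 0}\{g_i(x_i(k+1))^\top\lambda_i-\frac{1}{2c(k)}\|\lambda_i-\ell_i(k)\|^2\}$; - $\hat x_i(k+1)=\hat x_i(k)+\frac{c(k)}{\sum_{r=0}^k c(r)}(x_i(k+1)-\hat x_i(k))$. Assumptions. (Convexity) For each $i$, $f_i$ and each component of $g_i$ are convex on $\mathbb{R}^{n_i}$, and $X_i$ is convex. (Compactness) Each $X_i$ is compact. (Slater) There exists $\tilde x=(\tilde x_1,\dots,\tilde x_m)\in\operatorname{relint}(X)$ such that $\sum_{i=1}^m g_i(\tilde x_i)\le 0$ for those components of $\sum_{i=1}^m g_i(x_i)$ that are linear (i.e. affine) in $x$, if any, while $\sum_{i=1}^m g_i(\tilde x_i)<0$ for all other components. (Coefficient) $\{c(k)\}_{k\ge 0}$ is a non-increasing sequence of positive reals with $\sum_{k=0}^\infty c(k)=\infty$ and $\sum_{k=0}^\infty c(k)^2<\infty$. (Weights) There exists $\eta\in(0,1)$ such that for all $i,j\in\{1,\dots,m\}$ and all $k\ge 0$: $a_j^i(k)\in[0,1)$, $a_i^i(k)\ge\eta$, and $a_j^i(k)>0$ implies $a_j^i(k)\ge\eta$. Moreover, for all $k\ge 0$, $\sum_{j=1}^m a_j^i(k)=1$ for all $i$ and $\sum_{i=1}^m a_j^i(k)=1$ for all $j$. (Connectivity) Let $V=\{1,\dots,m\}$, $E_k=\{(j,i): a_j^i(k)>0\}$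 and $E_\infty=\{(j,i):(j,i)\in E_k\text{ for infinitely many }k\}$. The directed graph $(V,E_\infty)$ is strongly connected, and there exists $T\ge 1$ such that for every $(j,i)\in E_\infty$, agent $i$ receives information from agent $j$ at least once every $T$ consecutive iterations, i.e. for every $k\ge0$, $(j,i)\in E_k\cup E_{k+1}\cup\dots\cup E_{k+T-1}$. *)

(* Defs.v *)
From HB Require Import structures.
From mathcomp Require Import all_boot all_order all_algebra.
From mathcomp Require Import all_classical all_reals all_analysis.

Set Implicit Arguments.
Unset Strict Implicit.
Unset Printing Implicit Defensive.

Import Order.TTheory GRing.Theory Num.Theory.
Import numFieldNormedType.Exports.

Local Open Scope classical_set_scope.
Local Open Scope ring_scope.

Definition dotv (R : realType) (d : nat) (u v : 'rV[R]_d) : R :=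
  \sum_(l < d) u 0 l * v 0 l.

(* The library norm `|u| on 'rV[R]_d is the sup norm, hence this definition. *)
Definition enorm (R : realType) (d : nat) (u : 'rV[R]_d) : R :=
  Num.sqrt (dotv u u).

(* Extended-real valued, so that the distance to the empty set is +oo (the
   real-valued [inf] would give 0).  When the minimum of the distances is
   attained, this is that minimum. *)
Definition edist_set (R : realType) (d : nat) (y : 'rV[R]_d)
    (Z : set 'rV[R]_d) : \bar R :=
  ereal_inf [set (enorm (y - z))%:E | z in Z].

Definition affine_hull (R : realType) (d : nat) (A : set 'rV[R]_d) :
    set 'rV[R]_d :=
  [set y | exists (q : nat) (z : 'I_q -> 'rV[R]_d) (w : 'I_q -> R),
    [/\ forall i, A (z i), \sum_i w i = 1 & y = \sum_i w i *: z i]].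

Definition relint (R : realType) (d : nat) (A : set 'rV[R]_d) :
    set 'rV[R]_d :=
  [set x | A x /\ exists2 e : R, 0 < e &
    forall y, affine_hull A y -> enorm (y - x) < e -> A y].

Definition affine_fun (R : realType) (d : nat) (h : 'rV[R]_d -> R) : Prop :=
  exists (u : 'rV[R]_d) (b : R), forall x, h x = dotv u x + b.

Definition nonneg_orthant (R : realType) (p : nat) : set 'rV[R]_p :=
  [set u | forall l, 0 <= u 0 l].

Definition argmin (R : realType) (T : Type) (D : set T) (F : T -> R) : set T :=
  [set x | D x /\ forall y, D y -> F x <= F y].

Definition argmax (R : realType) (T : Type) (D : set T) (F : T -> R) : set T :=
  [set x | D x /\ forall y, D y -> F y <= F x].

(* A point of R^n, n = \sum_i n i, is a row vector whose i-th block
   [submxrow x i] is the decision vector of agent i. *)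

Definition prod_set (R : realType) (m : nat) (n : 'I_m -> nat)
    (X : forall i, set 'rV[R]_(n i)) : set 'rV[R]_(\sum_i n i) :=
  [set x | forall i, X i (submxrow x i)].

Definition total_cost (R : realType) (m : nat) (n : 'I_m -> nat)
    (f : forall i, 'rV[R]_(n i) -> R) (x : 'rV[R]_(\sum_i n i)) : R :=
  \sum_i f i (submxrow x i).

Definition coupling (R : realType) (m p : nat) (n : 'I_m -> nat)
    (g : forall i, 'rV[R]_(n i) -> 'rV[R]_p) (x : 'rV[R]_(\sum_i n i)) :
    'rV[R]_p :=
  \sum_i g i (submxrow x i).

Definition feasible (R : realType) (m p : nat) (n : 'I_m -> nat)
    (X : forall i, set 'rV[R]_(n i))
    (g : forall i, 'rV[R]_(n i) -> 'rV[R]_p) : set 'rV[R]_(\sum_i n i) :=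
  [set x | prod_set X x /\ forall l, coupling g x 0 l <= 0].

Definition primal_minimizers (R : realType) (m p : nat) (n : 'I_m -> nat)
    (X : forall i, set 'rV[R]_(n i)) (f : forall i, 'rV[R]_(n i) -> R)
    (g : forall i, 'rV[R]_(n i) -> 'rV[R]_p) : set 'rV[R]_(\sum_i n i) :=
  argmin (feasible X g) (total_cost f).

Definition convexity_assumption (R : realType) (m p : nat) (n : 'I_m -> nat)
    (X : forall i, set 'rV[R]_(n i)) (f : forall i, 'rV[R]_(n i) -> R)
    (g : forall i, 'rV[R]_(n i) -> 'rV[R]_p) : Prop :=
  forall i,
    [/\ convex_function setT (f i),
        forall l, convex_function setT (fun y => g i y 0 l)
      & convex_set (X i)].

Definition compactness_assumption (R : realType) (m : nat) (n : 'I_m -> nat)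
    (X : forall i, set 'rV[R]_(n i)) : Prop :=
  forall i, compact (X i).

Definition slater_assumption (R : realType) (m p : nat) (n : 'I_m -> nat)
    (X : forall i, set 'rV[R]_(n i))
    (g : forall i, 'rV[R]_(n i) -> 'rV[R]_p) : Prop :=
  exists2 xt, relint (prod_set X) xt &
    forall l : 'I_p,
      (affine_fun (fun x => coupling g x 0 l) -> coupling g xt 0 l <= 0) /\
      (~ affine_fun (fun x => coupling g x 0 l) -> coupling g xt 0 l < 0).

Definition coefficient_assumption (R : realType) (c : nat -> R) : Prop :=
  [/\ nonincreasing_seq c,
      forall k, 0 < c k,
      series c @ \oo --> +oo
    & cvgn (series (fun k => c k ^+ 2))].

(* [a k i j] is the weight a_j^i(k) that agent i gives at iteration k to the
   information received from agent j. *)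
Definition weights_assumption (R : realType) (m : nat)
    (a : nat -> 'I_m -> 'I_m -> R) : Prop :=
  (exists eta : R, 0 < eta < 1 /\
    forall (i j : 'I_m) (k : nat),
      [/\ 0 <= a k i j < 1, eta <= a k i i & 0 < a k i j -> eta <= a k i j]) /\
  forall k, (forall i, \sum_j a k i j = 1) /\ (forall j, \sum_i a k i j = 1).

Definition edge (R : realType) (m : nat) (a : nat -> 'I_m -> 'I_m -> R)
    (k : nat) (j i : 'I_m) : bool := 0 < a k i j.

Definition edge_infty (R : realType) (m : nat) (a : nat -> 'I_m -> 'I_m -> R)
    (j i : 'I_m) : Prop :=
  forall K : nat, exists2 k, (K <= k)%N & edge a k j i.

Definition connectivity_assumption (R : realType) (m : nat)
    (a : nat -> 'I_m -> 'I_m -> R) : Prop :=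
  (forall i j : 'I_m, connect (fun u v => `[< edge_infty a u v >]) i j) /\
  exists2 T : nat, (1 <= T)%N &
    forall j i : 'I_m, edge_infty a j i ->
      forall k : nat, exists2 t, (k <= t < k + T)%N & edge a t j i.

Definition mixed_multiplier (R : realType) (m p : nat)
    (a : nat -> 'I_m -> 'I_m -> R) (lam : nat -> 'I_m -> 'rV[R]_p)
    (k : nat) (i : 'I_m) : 'rV[R]_p :=
  \sum_j a k i j *: lam k j.

(* [x k i], [lam k i] and [xhat k i] are the iterates of agent i; [x 0] plays
   no role. *)
Definition generated_by_algorithm (R : realType) (m p : nat) (n : 'I_m -> nat)
    (X : forall i, set 'rV[R]_(n i)) (f : forall i, 'rV[R]_(n i) -> R)
    (g : forall i, 'rV[R]_(n i) -> 'rV[R]_p)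
    (a : nat -> 'I_m -> 'I_m -> R) (c : nat -> R)
    (x : nat -> forall i, 'rV[R]_(n i)) (lam : nat -> 'I_m -> 'rV[R]_p)
    (xhat : nat -> forall i, 'rV[R]_(n i)) : Prop :=
  (forall i, X i (xhat 0%N i) /\ @nonneg_orthant R p (lam 0%N i)) /\
  forall (k : nat) (i : 'I_m),
    let ell := mixed_multiplier a lam k i in
    [/\ argmin (X i) (fun y => f i y + dotv ell (g i y)) (x k.+1 i),
        argmax (@nonneg_orthant R p)
          (fun mu => dotv (g i (x k.+1 i)) mu
                     - (2 * c k)^-1 * enorm (mu - ell) ^+ 2)
          (lam k.+1 i)
      & xhat k.+1 i = xhat k i
          + (c k / \sum_(0 <= r < k.+1) c r) *: (x k.+1 i - xhat k i)].

(* Main.v *)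
(* No Lagrange multiplier is needed.  For a feasible y and any mu >= 0, comparing
   the projected step with mu and using the minimality of x(k+1) against y,
   the squared distance \sum_i |lam_i(k) - mu|^2 telescopes and gives
     2 c(k) (F(x(k+1)) + mu . G(x(k+1)) - F(y)) <= decrease + O(c(k)^2)
                                                    + O(c(k) * spread of lam(k)).
   The spread contracts by a fixed factor over a fixed window, up to an error
   O(c(k)), and c is non-increasing, so \sum_k c(k) * spread is bounded by a
   multiple of \sum_k c(k)^2.  Convexity then yields, with S_k = \sum_(r < k) c(r),
     S_k (F(xhat(k)) + mu . G(xhat(k)) - F(y)) <= C(mu, y).
   As S_k tends to infinity, every cluster point z of xhat satisfies
   F(z) + mu . G(z) <= F(y) for all mu >= 0 and all feasible y; letting mu grow
   gives G(z) <= 0 and mu = 0 gives optimality.  Compactness concludes; Slater's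
   condition only serves to provide a feasible point. *)

Require Import Defs.
From HB Require Import structures.
From mathcomp Require Import all_boot all_order all_algebra.
From mathcomp Require Import all_classical all_reals all_analysis.
From mathcomp Require Import ring lra zify.
Set Implicit Arguments.
Unset Strict Implicit.
Unset Printing Implicit Defensive.
Import Order.TTheory GRing.Theory Num.Theory.
Import numFieldNormedType.Exports.

Local Open Scope classical_set_scope.
Local Open Scope ring_scope.

(** * Consensus *)

Section Consensus.
Variables (R : realType) (m : nat) (a : nat -> 'I_m -> 'I_m -> R).

(** For non-negative weights this is the support of column [j] in the product of the weight matrices
    from time [k] to time [k + t - 1]. *)
Fixpoint reach (k : nat) (j : 'I_m) (t : nat) : {set 'I_m} :=
  if t is t'.+1 then
    [set i | [exists l in reach k j t', edge a (k + t') l i]]%SET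
  else [set j]%SET.

Hypothesis diag_gt0 : forall k i, 0 < a k i i.

Lemma reach_subS k j t : reach k j t \subset reach k j t.+1.
Proof.
apply/fintype.subsetP => i it; rewrite inE; apply/existsP; exists i.
by rewrite it /edge diag_gt0.
Qed.

Lemma reach_sub k j t t' : (t <= t')%N -> reach k j t \subset reach k j t'.
Proof.
move=> /subnK <-; elim: (t' - t)%N => [|d IH]; first exact: subxx.
exact: fintype.subset_trans IH (reach_subS _ _ _).
Qed.

Lemma reach0_mem k j t : j \in reach k j t.
Proof. by apply: (fintype.subsetP (reach_sub k j (leq0n t))); rewrite inE. Qed.

Variable T : nat.
Hypothesis conn : forall i j : 'I_m, connect (fun u v => `[< edge_infty a u v >]) i j.
Hypothesis window : forall j i : 'I_m, edge_infty a j i ->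
  forall k, exists2 t, (k <= t < k + T)%N & edge a t j i.

(** By strong connectivity a persistent edge leaves any incomplete set containing [j]. It is active
    once in the window, and self-loops preserve what was reached before and after. *)
Lemma reach_grow k j t : reach k j t != [set: 'I_m]%SET ->
  reach k j t \proper reach k j (t + T).
Proof.
move=> ntriv; set S := reach k j t in ntriv *.
have [u [w [uS wS uw]]] : exists u w, [/\ u \in S, w \notin S & edge_infty a u w].
  apply/not_existsP => noedge; move: ntriv; apply/negP; rewrite negbK.
  rewrite -finset.subTset; apply/fintype.subsetP => i _.
  have clr u v : edge_infty a u v -> u \in S -> v \in S.
    move=> uv uS; apply/negPn/negP => vS.
    by apply: (noedge u); exists v.
  have /connectP[q + ->] := conn j i.
  have : j \in S by exact: reach0_mem.
  elim: q (j) => [|v q IH] j0 j0S //= /andP[/asboolP j0v qP].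
  by apply: IH qP; apply: clr j0v j0S.
have [s /andP[ks sT] es] := window uw (k + t)%N.
apply/properP; split; first exact/reach_sub/leq_addr.
exists w => //.
have: w \in reach k j (s - k).+1.
  rewrite inE; apply/existsP; exists u; rewrite subnKC ?es ?andbT; last by lia.
  by apply: (fintype.subsetP (reach_sub k j _)) uS; lia.
by apply/fintype.subsetP/reach_sub; lia.
Qed.

(** Each window of length [T] adds an agent to an incomplete set, which starts with one element; [m]
    windows therefore exhaust all agents. *)
Lemma reach_full k j i : i \in reach k j (m * T).
Proof.
suff H r : reach k j (r * T) = [set: 'I_m]%SET \/ (r < #|reach k j (r * T)|)%N.
  have [->|] := H m; first by rewrite inE.
  by move=> /leq_trans /(_ (max_card _)); rewrite card_ord ltnn.
elim: r => [|r IH]; first by right; rewrite mul0n /= cards1.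
have sub : reach k j (r * T) \subset reach k j (r.+1 * T).
  by apply: reach_sub; rewrite mulSn leq_addl.
have [e|ne] := eqVneq (reach k j (r * T)) [set: 'I_m]%SET.
  by left; apply/eqP; rewrite -finset.subTset -e.
right; case: IH => [e|IH]; first by rewrite e eqxx in ne.
apply: (leq_ltn_trans IH); apply: proper_card.
by rewrite mulSn addnC; exact: reach_grow.
Qed.

(** The default [0] is also the value at diagonal pairs, so it alters the maximum only when there
    are no agents. *)
Definition spread (z : 'I_m -> R) : R :=
  \big[Num.max/0]_(q : 'I_m * 'I_m) (z q.1 - z q.2).

Lemma spread_ge0 z : 0 <= spread z.
Proof. by rewrite /spread; elim/big_rec: _ => // q y _ y0; rewrite le_max y0 orbT. Qed.

Lemma le_spread z i j : z i - z j <= spread z.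
Proof. exact: (le_bigmax _ (fun q : 'I_m * 'I_m => z q.1 - z q.2) (i, j)). Qed.

(** * Contraction of the spread under perturbed averaging *)

Variables (eta : R).
Hypothesis eta01 : 0 < eta < 1.
Hypothesis age0 : forall k i j, 0 <= a k i j.
Hypothesis edge_ge : forall k i j, 0 < a k i j -> eta <= a k i j.
Hypothesis row1 : forall k i, \sum_j a k i j = 1.

Lemma wavg_le k i (z : 'I_m -> R) hi :
  (forall j, z j <= hi) -> \sum_j a k i j * z j <= hi.
Proof.
move=> zhi; rewrite -[leRHS]mul1r -(row1 k i) mulr_suml.
by apply: ler_sum => j _; rewrite ler_wpM2l.
Qed.

(** Keeping the share of a single [j] lets its excess over [lo] travel along one edge. *)
Lemma wavg_ge k i j (z : 'I_m -> R) lo :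
  (forall j, lo <= z j) -> lo + a k i j * (z j - lo) <= \sum_j a k i j * z j.
Proof.
move=> zlo.
have -> : \sum_j a k i j * z j = lo + \sum_j a k i j * (z j - lo).
  under [in RHS]eq_bigr do rewrite mulrBr.
  by rewrite sumrB -mulr_suml row1 mul1r addrC subrK.
rewrite lerD2l (bigD1 j) //= lerDl sumr_ge0 // => l _.
by rewrite mulr_ge0 // subr_ge0.
Qed.

Variables (y : nat -> 'I_m -> R) (c : nat -> R) (L : R).
Hypothesis c_ge0 : forall k, 0 <= c k.
Hypothesis c_noninc : forall k l, (k <= l)%N -> c l <= c k.
Hypothesis L_ge0 : 0 <= L.
Hypothesis ystep : forall k i,
  `|y k.+1 i - \sum_j a k i j * y k j| <= L * c k.

Lemma ystep_near k t i : `|y (k + t).+1 i - \sum_j a (k + t)%N i j * y (k + t)%N j| <= L * c k.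
Proof. by apply: le_trans (ystep _ _) _; rewrite ler_wpM2l // c_noninc ?leq_addr. Qed.

Lemma iter_upper k hi t i : (forall j, y k j <= hi) ->
  y (k + t)%N i <= hi + t%:R * (L * c k).
Proof.
move=> yhi; elim: t i => [|t IH] i; first by rewrite addn0 mul0r addr0.
have := wavg_le (k + t) i IH; have := ystep_near k t i.
by rewrite addnS ler_norml -natr1; lra.
Qed.

(** The first bound is the floor required by [wavg_ge]. In the second, each edge on a path from [j]
    retains at least a fraction [eta] of the initial excess of [j]. *)
Lemma iter_lower k lo t j : (forall j, lo <= y k j) ->
  (forall i, lo - t%:R * (L * c k) <= y (k + t)%N i) /\
  (forall i, i \in reach k j t ->
     lo - t%:R * (L * c k) + eta ^+ t * (y k j - lo) <= y (k + t)%N i).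
Proof.
move=> ylo; elim: t => [|t [IH1 IH2]].
  split=> i; rewrite addn0 mul0r subr0 //= inE => /eqP ->.
  by rewrite mul1r addrC subrK.
have step l i := wavg_ge (k + t) i l IH1.
have e0 : 0 <= L * c k by rewrite mulr_ge0.
split=> i; have := ystep_near k t i; rewrite addnS ler_norml -natr1.
  have := step i i; have := IH1 i; rewrite -subr_ge0 => h.
  have := mulr_ge0 (age0 (k + t) i i) h; lra.
move=> yst; rewrite /= inE => /existsP[l /andP[lt el]].
(* One factor [eta] comes from the edge from [l] to [i], the others from the induction hypothesis at
   [l]. *)
have h : eta ^+ t.+1 * (y k j - lo) <= a (k + t)%N i l * (y (k + t)%N l - (lo - t%:R * (L * c k))).
  rewrite exprS -mulrA ler_pM //.
  - by case/andP: eta01 => /ltW.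
  - by rewrite mulr_ge0 ?subr_ge0 // exprn_ge0 //; case/andP: eta01 => /ltW.
  - exact: edge_ge.
  - by have := IH2 l lt; lra.
have := step l i; lra.
Qed.

Let B := (m * T)%N.

(** After [B] steps every agent has been reached from one with the largest value, so the minimum
    rises by [eta ^+ B] times the old spread, while the maximum grows only by accumulated errors. *)
Lemma spread_contract k :
  spread (y (k + B)%N) <= (1 - eta ^+ B) * spread (y k) + 2 * B%:R * (L * c k).
Proof.
have [eta0 eta1] := andP eta01.
have eB1 : eta ^+ B <= 1 by rewrite exprn_ile1 // ltW.
have e0 : 0 <= L * c k by rewrite mulr_ge0.
apply: bigmax_le => [|[i i'] _ /=].
  by rewrite addr_ge0 ?mulr_ge0 ?subr_ge0 ?spread_ge0 ?c_ge0.
have [jhi _ hhi] := @Order.TotalTheory.arg_maxP _ _ 'I_m i predT (y k) isT.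
have [jlo _ hlo] := @Order.TotalTheory.arg_minP _ _ 'I_m i predT (y k) isT.
have up := @iter_upper k _ B i (fun j => hhi j isT).
have [_ /(_ i' (reach_full k jhi i')) lw] := @iter_lower k _ B jhi (fun j => hlo j isT).
have : (1 - eta ^+ B) * (y k jhi - y k jlo) <= (1 - eta ^+ B) * spread (y k).
  by rewrite ler_wpM2l ?subr_ge0 ?le_spread.
lra.
Qed.

(** Shifting the sum by [B] and using both the contraction and [c (k + B) <= c k] gives an
    inequality with [U K] on both sides, with coefficient [1 - eta ^+ B] on the right. *)
Lemma sum_spread_bounded (Q : R) :
  (forall K, \sum_(0 <= k < K) c k ^+ 2 <= Q) ->
  exists C, forall K, \sum_(0 <= k < K) c k * spread (y k) <= C.
Proof.
move=> cQ; have [eta0 eta1] := andP eta01.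
pose U K := \sum_(0 <= k < K) c k * spread (y k).
have eB0 : 0 < eta ^+ B by rewrite exprn_gt0.
have eB1 : eta ^+ B <= 1 by rewrite exprn_ile1 // ltW.
(* This solves [U K <= U B + (1 - eta ^+ B) * U K + 2 * B * L * Q] for [U K]. *)
exists ((U B + 2 * B%:R * L * Q) / eta ^+ B) => K; rewrite ler_pdivlMr //.
have cs0 k : 0 <= c k * spread (y k) by rewrite mulr_ge0 ?spread_ge0.
have U1 : U K <= U (K + B)%N.
  by rewrite /U [leRHS](big_cat_nat (n := K)) ?leq_addr //= lerDl sumr_ge0.
have U2 : U (K + B)%N = U B + \sum_(0 <= k < K) c (k + B)%N * spread (y (k + B)%N).
  rewrite /U [LHS](big_cat_nat (n := B)) ?leq_addl //=; congr (_ + _).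
  by rewrite -{1}[B]add0n big_addn addnK.
have U3 : \sum_(0 <= k < K) c (k + B)%N * spread (y (k + B)%N) <=
    (1 - eta ^+ B) * U K + 2 * B%:R * L * \sum_(0 <= k < K) c k ^+ 2.
  rewrite !mulr_sumr -big_split /=; apply: ler_sum => k _.
  have := spread_contract k; have := c_noninc (leq_addr B k).
  have := spread_ge0 (y (k + B)%N) => s0 cc sc.
  have := ler_wpM2r s0 cc; have := ler_wpM2l (c_ge0 k) sc; nra.
have : 2 * B%:R * L * \sum_(0 <= k < K) c k ^+ 2 <= 2 * B%:R * L * Q.
  by rewrite ler_wpM2l // !mulr_ge0.
rewrite -/(U K); nra.
Qed.

End Consensus.

(** * Convex functions *)

Section Convexity.
Variables (R : realType) (d : nat).
Implicit Types (f : 'rV[R]_d -> R) (x v h : 'rV[R]_d).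

Lemma convex_function_le f x y t : convex_function setT f -> 0 <= t <= 1 ->
  f (t *: x + (1 - t) *: y) <= t * f x + (1 - t) * f y.
Proof.
move=> fc /andP[t0 t1].
by have := fc (Itv01 t0 t1) x y; rewrite !in_setT => /(_ isT isT).
Qed.

Lemma convex_set_mem (X : set 'rV[R]_d) x y t : convex_set X -> 0 <= t <= 1 ->
  X x -> X y -> X (t *: x + (1 - t) *: y).
Proof.
move=> Xc /andP[t0 t1] Xx Xy.
by have := Xc x y (Itv01 t0 t1); rewrite !inE; apply.
Qed.

(** The point is a convex combination of [x] and of [x + v] or [x - v], by the sign of [s]; adding
    both increments covers the two cases. *)
Lemma convex_ray_upper f x v s : convex_function setT f -> `|s| <= 1 ->
  f (x + s *: v) - f x <= `|s| * (`|f (x + v) - f x| + `|f (x - v) - f x|).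
Proof.
move=> fc s1; have sI : 0 <= `|s| <= 1 by rewrite normr_ge0.
suff [w []] : exists w, x + s *: v = `|s| *: w + (1 - `|s|) *: x /\
    f w - f x <= `|f (x + v) - f x| + `|f (x - v) - f x|.
  move=> -> fw; have := convex_function_le w x fc sI.
  have := ler_wpM2l (normr_ge0 s) fw; lra.
have [s0|s0] := ger0P s.
  exists (x + v); split; last by rewrite (le_trans (ler_norm _)) ?lerDl.
  by apply/rowP => l; rewrite !mxE; ring.
exists (x - v); split; last by rewrite (le_trans (ler_norm _)) ?lerDr.
by apply/rowP => l; rewrite !mxE; ring.
Qed.

(* Midpoint convexity peels off one direction at a time:
   x + s v + w = (x + 2 s v) / 2 + (x + 2 w) / 2. *)
Lemma convex_span_upper f x q (v : 'I_q -> 'rV[R]_d) : convex_function setT f ->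
  exists2 C : R, 0 <= C & forall (s : 'I_q -> R) (e : R), 0 <= e <= 1 ->
    (forall i, `|s i| <= e) -> f (x + \sum_i s i *: v i) - f x <= C * e.
Proof.
move=> fc; elim: q v => [|q IH] v.
  by exists 0 => // s e _ _; rewrite big_ord0 addr0 subrr mul0r.
(* Doubling the remaining directions absorbs the midpoint factor, so the coefficients [s] stay
   unchanged. *)
have [C C0 HC] := IH (fun i => 2 *: v (lift ord0 i)).
pose D := `|f (x + 2 *: v ord0) - f x| + `|f (x - 2 *: v ord0) - f x|.
have D0 : 0 <= D by rewrite addr_ge0.
exists (2^-1 * (D + C)) => [|s e e01 se]; first by rewrite mulr_ge0 ?addr_ge0.
rewrite big_ord_recl; set w := \sum_(i < q) _.
have -> : x + (s ord0 *: v ord0 + w) =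
    2^-1 *: (x + s ord0 *: (2 *: v ord0)) + (1 - 2^-1) *: (x + 2 *: w).
  by apply/rowP => l; rewrite !mxE; field.
have h01 : 0 <= (2^-1 : R) <= 1 by lra.
have [e0 e1] := andP e01.
have := convex_function_le (x + s ord0 *: (2 *: v ord0)) (x + 2 *: w) fc h01.
have := convex_ray_upper x (2 *: v ord0) fc (le_trans (se ord0) e1).
have := HC (fun i => s (lift ord0 i)) e e01 (fun i => se _).
have -> : \sum_(i < q) s (lift ord0 i) *: (2 *: v (lift ord0 i)) = 2 *: w.
  by rewrite scaler_sumr; apply: eq_bigr => i _; rewrite !scalerA mulrC.
have := ler_wpM2r D0 (se ord0); rewrite -/D; lra.
Qed.

Lemma coord_le_norm h l : `|h 0 l| <= `|h|.
Proof.
rewrite [leRHS]/Num.norm /= mx_normrE.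
exact: (le_bigmax _ (fun q : 'I_1 * 'I_d => `|h q.1 q.2|) (0, l)).
Qed.

Lemma convex_local_upper f x : convex_function setT f ->
  exists2 C : R, 0 <= C & forall h, `|h| <= 1 -> f (x + h) - f x <= C * `|h|.
Proof.
move=> fc; have [C C0 HC] := convex_span_upper x (fun i => delta_mx 0 i) fc.
exists C => // h h1; rewrite {1}[h]row_sum_delta.
by apply: HC => [|i]; rewrite ?normr_ge0 ?coord_le_norm.
Qed.

(** The local upper bound at [x - h], combined with midpoint convexity at [x], yields the lower
    bound at [x + h]. *)
Lemma convex_continuous f : convex_function setT f -> continuous f.
Proof.
move=> fc x; have [C C0 HC] := convex_local_upper x fc.
apply: (@cvgrPdist_le _ _ _ (nbhs x) _ f (f x)).2 => e e0.
have C1 : 0 < C + 1 by lra.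
(* The constant [C] may vanish, hence the division by [C + 1]. *)
apply/nbhs_ballP; exists (Num.min 1 (e / (C + 1))) => /=.
  by rewrite lt_min ltr01 divr_gt0.
move=> y /=; rewrite mx_norm_ball /ball_ /= lt_min => /andP[h1 he].
set h := y - x; have hE : `|h| = `|x - y| by rewrite distrC.
have Ce : C * `|h| <= e.
  rewrite hE; move: he; rewrite ltr_pdivlMr // => he.
  have := normr_ge0 (x - y); nra.
have hy : x + h = y by rewrite /h addrC subrK.
have h1' : `|h| <= 1 by rewrite hE ltW.
have := HC h h1'; have := HC (- h); rewrite normrN => /(_ h1').
have h01 : 0 <= (2^-1 : R) <= 1 by lra.
have := convex_function_le (x + h) (x - h) fc h01.
have -> : 2^-1 *: (x + h) + (1 - 2^-1) *: (x - h) = x.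
  by apply/rowP => l; rewrite !mxE; field.
rewrite hy ler_norml => mid dn up.
by apply/andP; split; lra.
Qed.

(** Jensen's inequality, one point at a time. The first step has coefficient 1, so [xhat 0] is
    forgotten. *)
Lemma convex_running_average f (c : nat -> R) (x xhat : nat -> 'rV[R]_d) :
  convex_function setT f -> (forall k, 0 < c k) ->
  (forall k, xhat k.+1 = xhat k
     + (c k / \sum_(0 <= r < k.+1) c r) *: (x k.+1 - xhat k)) ->
  forall K, (\sum_(0 <= r < K) c r) * f (xhat K) <= \sum_(0 <= r < K) c r * f (x r.+1).
Proof.
move=> fc c0 xhatS; elim=> [|K IH]; first by rewrite !big_geq // mul0r.
have S0 : 0 <= \sum_(0 <= r < K) c r by rewrite sumr_ge0 // => r _; exact: ltW.
rewrite [leRHS]big_nat_recr //= xhatS; set S := \sum_(0 <= r < K.+1) c r.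
have SE : S = \sum_(0 <= r < K) c r + c K by rewrite /S big_nat_recr.
have Sp : 0 < S by rewrite SE ltr_wpDl.
set t := c K / S.
have tI : 0 <= t <= 1.
  rewrite divr_ge0 ?(ltW (c0 _)) ?(ltW Sp) //= ler_pdivrMr // mul1r SE lerDr //.
have -> : xhat K + t *: (x K.+1 - xhat K) = t *: x K.+1 + (1 - t) *: xhat K.
  by rewrite scalerBr scalerBl scale1r addrCA.
have := convex_function_le (x K.+1) (xhat K) fc tI => /(ler_wpM2l (ltW Sp)).
have St : S * t = c K by rewrite mulrCA divff ?mulr1 ?gt_eqF.
have -> : S * (t * f (x K.+1) + (1 - t) * f (xhat K)) =
  S * t * f (x K.+1) + (S - S * t) * f (xhat K) by ring.
rewrite St SE addrK; lra.
Qed.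

End Convexity.

(** * The multiplier step *)

Section Scalar.
Variable R : realType.
Implicit Types (g z t c mu : R).

(** Completing the square turns the maximization into projecting [ell + c * g] onto the non-negative
    half-line. *)
Lemma prox_orthantE g ell c z : 0 < c -> 0 <= z ->
  (forall t, 0 <= t -> g * t - (2 * c)^-1 * (t - ell) ^+ 2 <=
                        g * z - (2 * c)^-1 * (z - ell) ^+ 2) ->
  z = Num.max 0 (ell + c * g).
Proof.
move=> c0 z0 zmax; set t := Num.max _ _.
have t0 : 0 <= t by rewrite le_max lexx.
have {zmax} : (z - (ell + c * g)) ^+ 2 <= (t - (ell + c * g)) ^+ 2.
  have := ler_wpM2l (_ : 0 <= 2 * c) (zmax t t0).
  rewrite !mulrBr !mulrA !mulfV ?mul1r ?mulf_neq0 ?gt_eqF ?pnatr_eq0 //.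
  by move=> /(_ (mulr_ge0 (ler0n _ _) (ltW c0))); nra.
rewrite /t; have [s0|s0] := leP 0 (ell + c * g).
  by rewrite subrr expr0n /= => h; apply/eqP; rewrite -subr_eq0 -sqrf_eq0 eq_le h sqr_ge0.
by move=> h; apply/eqP; rewrite eq_le z0 andbT; nra.
Qed.

Lemma orthant_step_sqr_le ell c g mu : 0 <= mu ->
  (Num.max 0 (ell + c * g) - mu) ^+ 2 <= (ell + c * g - mu) ^+ 2.
Proof. by move=> mu0; have [//|s0] := leP 0 (ell + c * g); nra. Qed.

Lemma orthant_step_dist ell c g : 0 <= c -> 0 <= ell ->
  `|Num.max 0 (ell + c * g) - ell| <= c * `|g|.
Proof.
move=> c0 l0; have := ler_wpM2l c0 (ler_norm (- g)); have := ler_wpM2l c0 (ler_norm g).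
rewrite normrN ler_norml; have [s0|s0] := leP 0 (ell + c * g) => *; apply/andP; split; lra.
Qed.

(** The difference of the two sides is the variance of [z] under [w]. *)
Lemma sqr_wavg_le q (w z : 'I_q -> R) : (forall j, 0 <= w j) -> \sum_j w j = 1 ->
  (\sum_j w j * z j) ^+ 2 <= \sum_j w j * z j ^+ 2.
Proof.
move=> w0 w1; set s := \sum_j w j * z j.
have : 0 <= \sum_j w j * (z j - s) ^+ 2.
  by apply: sumr_ge0 => j _; rewrite mulr_ge0 ?sqr_ge0.
have -> : \sum_j w j * (z j - s) ^+ 2 =
    \sum_j w j * z j ^+ 2 - 2 * s * (\sum_j w j * z j) + s ^+ 2 * \sum_j w j.
  move: s => s; rewrite !mulr_sumr -sumrB -big_split /=; apply: eq_bigr => j _; ring.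
by rewrite w1 -/s; nra.
Qed.

(** Row sums allow convexity of the square in each row; column sums then collapse the exchanged
    double sum. *)
Lemma doubly_stochastic_sqr_le q (A : 'I_q -> 'I_q -> R) (z : 'I_q -> R) mu :
  (forall i j, 0 <= A i j) -> (forall i, \sum_j A i j = 1) ->
  (forall j, \sum_i A i j = 1) ->
  \sum_i (\sum_j A i j * z j - mu) ^+ 2 <= \sum_i (z i - mu) ^+ 2.
Proof.
move=> A0 r1 c1.
have <- : \sum_i \sum_j A i j * (z j - mu) ^+ 2 = \sum_i (z i - mu) ^+ 2.
  rewrite exchange_big /=; apply: eq_bigr => j _.
  by rewrite -mulr_suml c1 mul1r.
apply: ler_sum => i _; have -> : \sum_j A i j * z j - mu = \sum_j A i j * (z j - mu).
  by under [RHS]eq_bigr do rewrite mulrBr; rewrite sumrB -mulr_suml r1 mul1r.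
exact: sqr_wavg_le.
Qed.

End Scalar.

(** * The ergodic gap *)

Lemma enorm_sqr (R : realType) d (u : 'rV[R]_d) : enorm u ^+ 2 = \sum_l u 0 l ^+ 2.
Proof.
rewrite /enorm sqr_sqrtr; last by apply: sumr_ge0 => l _; rewrite -expr2 sqr_ge0.
by apply: eq_bigr => l _; rewrite expr2.
Qed.

Lemma prox_orthant_rVE (R : realType) p (c : R) (g ell z : 'rV[R]_p) l : 0 < c ->
  argmax (@nonneg_orthant R p)
    (fun mu => dotv g mu - (2 * c)^-1 * enorm (mu - ell) ^+ 2) z ->
  z 0 l = Num.max 0 (ell 0 l + c * g 0 l).
Proof.
move=> c0 [z0 zmax]; apply: (prox_orthantE c0 (z0 l)) => t t0.
(* The objective is separable, so a competitor differing from [z] only at [l] isolates that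
   coordinate. *)
pose mu : 'rV[R]_p := \row_j (if j == l then t else z 0 j).
have mu0 : nonneg_orthant mu by move=> j; rewrite mxE; case: eqP => // _; exact: z0.
have obj (u : 'rV[R]_p) : dotv g u - (2 * c)^-1 * enorm (u - ell) ^+ 2 =
    \sum_j (g 0 j * u 0 j - (2 * c)^-1 * (u 0 j - ell 0 j) ^+ 2).
  rewrite enorm_sqr mulr_sumr sumrB; congr (_ - _).
  by apply: eq_bigr => j _; rewrite !mxE.
have := zmax mu mu0; rewrite !obj [leLHS](bigD1 l) //= [leRHS](bigD1 l) //= !mxE eqxx.
rewrite (eq_bigr (fun j => g 0 j * z 0 j - (2 * c)^-1 * (z 0 j - ell 0 j) ^+ 2)).
  by rewrite lerD2r.
by move=> j /negPf jl; rewrite !mxE jl.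
Qed.

(** * Invariants of the iterates and disagreement of the multipliers *)

Section Algorithm.
Variables (R : realType) (m p : nat) (n : 'I_m -> nat)
  (X : forall i, set 'rV[R]_(n i))
  (f : forall i, 'rV[R]_(n i) -> R) (g : forall i, 'rV[R]_(n i) -> 'rV[R]_p)
  (a : nat -> 'I_m -> 'I_m -> R) (c : nat -> R)
  (x : nat -> forall i, 'rV[R]_(n i)) (lam : nat -> 'I_m -> 'rV[R]_p)
  (xhat : nat -> forall i, 'rV[R]_(n i)).
Hypotheses (cvxA : convexity_assumption X f g) (cptA : compactness_assumption X)
  (coefA : coefficient_assumption c) (wA : weights_assumption a)
  (connA : connectivity_assumption a)
  (algA : generated_by_algorithm X f g a c x lam xhat).

Local Notation ell := (mixed_multiplier a lam).

Let c_gt0 k : 0 < c k. Proof. by case: coefA. Qed.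

Let c_noninc k l : (k <= l)%N -> c l <= c k.
Proof. by case: coefA => + _ _ _; exact. Qed.

Let a_ge0 k i j : 0 <= a k i j.
Proof. by case: wA => -[eta [_ /(_ i j k)[/andP[]]]]. Qed.

Let a_row k i : \sum_j a k i j = 1. Proof. by case: wA => _ /(_ k)[]. Qed.

Let a_col k j : \sum_i a k i j = 1. Proof. by case: wA => _ /(_ k)[]. Qed.

Lemma ellE k i l : ell k i 0 l = \sum_j a k i j * lam k j 0 l.
Proof. by rewrite /mixed_multiplier summxE; apply: eq_bigr => j _; rewrite mxE. Qed.

Lemma lam_ge0 k i l : 0 <= lam k i 0 l.
Proof.
case: algA => h0 h; case: k => [|k]; first exact: (h0 i).2.
by have [_ [+ _] _] := h k i; exact.
Qed.

Lemma ell_ge0 k i l : 0 <= ell k i 0 l.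
Proof. by rewrite ellE; apply: sumr_ge0 => j _; rewrite mulr_ge0 ?lam_ge0. Qed.

Lemma lamSE k i l :
  lam k.+1 i 0 l = Num.max 0 (ell k i 0 l + c k * g (x k.+1 i) 0 l).
Proof. by have [_ /prox_orthant_rVE -> //] := algA.2 k i. Qed.

Lemma x_mem k i : X (x k.+1 i).
Proof. by have [[]] := algA.2 k i. Qed.

Lemma xhat_mem k i : X (xhat k i).
Proof.
elim: k => [|k IH]; first by case: algA => h _; exact: (h i).1.
have [[Xx _] _ ->] := algA.2 k i.
set t := _ / _.
have S0 : 0 < \sum_(0 <= r < k.+1) c r.
  by rewrite big_nat_recr //= ltr_wpDl // sumr_ge0 // => r _; exact: ltW.
have -> : xhat k i + t *: (x k.+1 i - xhat k i) = t *: x k.+1 i + (1 - t) *: xhat k i.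
  by apply/rowP => l; rewrite !mxE; ring.
have [_ _ Xc] := cvxA i; apply: convex_set_mem => //.
rewrite divr_ge0 ?(ltW (c_gt0 _)) ?(ltW S0) //= ler_pdivrMr // mul1r.
by rewrite big_nat_recr //= lerDr sumr_ge0 // => r _; exact: ltW.
Qed.

Lemma g_bounded : exists2 L : R, 0 <= L &
  forall i z l, X z -> `|g (i := i) z 0 l| <= L.
Proof.
have H (q : 'I_m * 'I_p) : exists B : R, forall z, X (i := q.1) z -> `|g (i := q.1) z 0 q.2| <= B.
  case: q => i l /=; have [_ /(_ l) gc _] := cvxA i.
  have cg : {within X (i := i), continuous (fun z => g (i := i) z 0 l : R)}.
    exact/continuous_subspaceT/convex_continuous.
  have /compact_bounded[M [_ HM]] := continuous_compact cg (@cptA i).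
  (* Boundedness only supplies bounds strictly above [M]. *)
  exists (M + 1) => z Xz; apply: (HM (M + 1)); first by rewrite ltrDl.
  by exists z.
have [B HB] := choice H.
exists (\sum_q `|B q|) => [|i z l Xz]; first by rewrite sumr_ge0.
apply: le_trans (HB (i, l) z Xz) _; apply: le_trans (ler_norm _) _.
by rewrite (bigD1 (i, l)) //= lerDl sumr_ge0.
Qed.

Let sqr_sum_bounded : exists Q, forall K, \sum_(0 <= k < K) c k ^+ 2 <= Q.
Proof.
case: coefA => _ _ _ /cvg_seq_bounded [M [_ HM]].
by exists (M + 1) => K; apply: le_trans (ler_norm _) (HM _ _ K I); rewrite ltrDl.
Qed.

(** For each coordinate, the multiplier update is averaging plus an error at most [L * c k], since
    the projected step moves no further than [c k] times the constraint value. *)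
Lemma sum_disagreement_bounded l : exists C, forall K,
  \sum_(0 <= k < K) c k * spread (fun i => lam k i 0 l) <= C.
Proof.
have [Q HQ] := sqr_sum_bounded; have [L L0 HL] := g_bounded.
case: wA => -[eta [eta01 Heta]] _; case: connA => conn [T _ window].
apply: (@sum_spread_bounded _ _ a _ T conn window eta eta01 a_ge0 _ a_row
  (fun k i => lam k i 0 l) c L _ c_noninc L0 _ Q HQ).
- by move=> k i; have [_ h _] := Heta i i k; apply: lt_le_trans h; case/andP: eta01.
- by move=> k i j; have [_ _] := Heta i j k.
- by move=> k; exact: ltW.
- move=> k i; rewrite lamSE -ellE.
  apply: le_trans (orthant_step_dist _ (ltW (c_gt0 k)) (ell_ge0 k i l)) _.
  by rewrite mulrC ler_wpM2r ?(ltW (c_gt0 k)) // HL //; exact: x_mem.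
Qed.

(** A common non-negative reference lets the aggregate constraint of a feasible point be used,
    although each agent has its own multiplier. Any agent's multiplier serves; with no agents, [0]
    does. *)
Lemma disagreement_ref k l : exists2 v : R, 0 <= v &
  forall i, `|ell k i 0 l - v| <= spread (fun i => lam k i 0 l).
Proof.
case: (pickP 'I_m) => [i0 _|no]; last by exists 0 => // i; have := no i.
exists (lam k i0 0 l) => [|i]; first exact: lam_ge0.
have le_ref j : lam k i0 0 l - spread (fun i => lam k i 0 l) <= lam k j 0 l.
  by have := le_spread (fun i => lam k i 0 l) i0 j; lra.
rewrite ellE ler_norml; apply/andP; split.
  have := wavg_ge a_ge0 a_row k i i0 le_ref.
  have := mulr_ge0 (a_ge0 k i i0) (spread_ge0 (fun i => lam k i 0 l)); lra.
rewrite lerBlDr; apply: wavg_le => // j.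
by have := le_spread (fun i => lam k i 0 l) j i0; lra.
Qed.

(** * Descent of the squared distance to a fixed multiplier *)

Section Ergodic.
Variables (y : forall i, 'rV[R]_(n i)) (mu : 'I_p -> R).
Hypotheses (Xy : forall i, X (y i)) (gy : forall l, \sum_i g (y i) 0 l <= 0)
  (mu0 : forall l, 0 <= mu l).

Definition lagrangian i (z : 'rV[R]_(n i)) := f z + \sum_l mu l * g z 0 l.

Let W k := \sum_i \sum_l (lam k i 0 l - mu l) ^+ 2.

(** The terms [g * (ell - mu)] in [Wle] and [main] cancel. The [c k ^+ 2] term is the squared
    gradient step; the spread term is the cost of replacing each [ell] by the common reference at
    [y]. *)
Lemma descent_step L k : 0 <= L -> (forall i z l, X z -> `|g (i := i) z 0 l| <= L) ->
  2 * (c k * \sum_i (lagrangian (x k.+1 i) - f (y i))) <=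
    W k - W k.+1 + m%:R * p%:R * L ^+ 2 * c k ^+ 2
    + 2 * m%:R * L * \sum_l c k * spread (fun i => lam k i 0 l).
Proof.
move=> L0 HL; have ck := ltW (c_gt0 k).
pose D l := spread (fun i => lam k i 0 l).
have /choice[v Hv] l : exists v : R, 0 <= v /\ forall i, `|ell k i 0 l - v| <= D l.
  by have [v v0 hv] := disagreement_ref k l; exists v.
have Wle : W k.+1 <= W k + 2 * (c k * \sum_i \sum_l g (x k.+1 i) 0 l * (ell k i 0 l - mu l))
    + m%:R * p%:R * L ^+ 2 * c k ^+ 2.
  apply: (@le_trans _ _ (\sum_i \sum_l ((ell k i 0 l - mu l) ^+ 2 +
    2 * (c k * (g (x k.+1 i) 0 l * (ell k i 0 l - mu l))) + L ^+ 2 * c k ^+ 2))).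
    apply: ler_sum => i _; apply: ler_sum => l _; rewrite lamSE.
    apply: le_trans (orthant_step_sqr_le _ _ _ (mu0 l)) _.
    have : g (x k.+1 i) 0 l ^+ 2 <= L ^+ 2.
      by rewrite -[g _ _ _ ^+ 2]real_normK ?num_real // lerXn2r ?nnegrE // HL //; exact: x_mem.
    move/(ler_wpM2l (sqr_ge0 (c k))); lra.
  have -> : m%:R * p%:R * L ^+ 2 * c k ^+ 2 = \sum_(i < m) \sum_(l < p) L ^+ 2 * c k ^+ 2.
    by rewrite !sumr_const !card_ord -mulrnA -[in RHS]mulr_natl natrM; ring.
  (* Double stochasticity: mixing does not increase the total squared distance to [mu]. *)
  have Wmix : \sum_i \sum_l (ell k i 0 l - mu l) ^+ 2 <= W k.
    rewrite /W exchange_big [leRHS]exchange_big /=; apply: ler_sum => l _.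
    under eq_bigr do rewrite ellE.
    exact: (doubly_stochastic_sqr_le (fun j => lam k j 0 l)).
  do 2!under eq_bigr do rewrite big_split /=; rewrite !big_split /=.
  rewrite !lerD //.
  by rewrite !mulr_sumr; apply: ler_sum => i _; rewrite !mulr_sumr.
have main : \sum_i (lagrangian (x k.+1 i) - f (y i)) <=
    m%:R * L * \sum_l D l - \sum_i \sum_l g (x k.+1 i) 0 l * (ell k i 0 l - mu l).
  apply: (@le_trans _ _ (\sum_i \sum_l ell k i 0 l * g (y i) 0 l
     - \sum_i \sum_l g (x k.+1 i) 0 l * (ell k i 0 l - mu l))).
    rewrite -sumrB; apply: ler_sum => i _; rewrite /lagrangian -sumrB.
    have [[_ /(_ (y i) (Xy i)) /= xmin] _ _] := algA.2 k i; move: xmin; rewrite /dotv.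
    have -> : \sum_l (ell k i 0 l * g (y i) 0 l - g (x k.+1 i) 0 l * (ell k i 0 l - mu l)) =
      \sum_l ell k i 0 l * g (y i) 0 l - \sum_l ell k i 0 l * g (x k.+1 i) 0 l
      + \sum_l mu l * g (x k.+1 i) 0 l.
      by rewrite -sumrB -big_split /=; apply: eq_bigr => l _; ring.
    lra.
  rewrite lerD2r exchange_big /= mulr_sumr; apply: ler_sum => l _.
  have [v0 hv] := Hv l.
  (* The part carrying [v l] is non-positive by feasibility of [y]; the rest is at most [D l * L]
     per agent. *)
  have -> : \sum_i ell k i 0 l * g (y i) 0 l =
     \sum_i (ell k i 0 l - v l) * g (y i) 0 l + v l * \sum_i g (y i) 0 l.
    by rewrite mulr_sumr -big_split /=; apply: eq_bigr => i _; ring.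
  have : \sum_i (ell k i 0 l - v l) * g (y i) 0 l <= \sum_(i < m) D l * L.
    apply: ler_sum => i _; apply: le_trans (ler_norm _) _.
    by rewrite normrM ler_pM // HL.
  have -> : \sum_(i < m) D l * L = m%:R * (D l * L) by rewrite sumr_const card_ord mulr_natl.
  have := mulr_ge0_le0 v0 (gy l); lra.
have := ler_wpM2l ck main; rewrite -mulr_sumr -/(D _); lra.
Qed.

(** The differences of [W] telescope, the final [W K] is non-negative, and both error series are
    bounded. *)
Lemma weighted_gap_bounded : exists C, forall K,
  \sum_(0 <= k < K) c k * \sum_i (lagrangian (x k.+1 i) - f (y i)) <= C.
Proof.
have [L L0 HL] := g_bounded; have [Q HQ] := sqr_sum_bounded.
have /choice[Cl HC] := sum_disagreement_bounded.
exists (2^-1 * (W 0%N + m%:R * p%:R * L ^+ 2 * Q + 2 * m%:R * L * \sum_l Cl l)) => K.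
have tele : 2 * \sum_(0 <= k < K) c k * \sum_i (lagrangian (x k.+1 i) - f (y i)) <=
    W 0%N - W K + m%:R * p%:R * L ^+ 2 * \sum_(0 <= k < K) c k ^+ 2
    + 2 * m%:R * L * \sum_l \sum_(0 <= k < K) c k * spread (fun i => lam k i 0 l).
  elim: K => [|K IH].
    rewrite !big_geq // mulr0 subrr add0r mulr0 big1 ?mulr0 ?addr0 // => l _.
    by rewrite big_geq.
  have := descent_step K L0 HL.
  rewrite [in X in _ -> X]big_nat_recr //= [in X in _ -> X](big_nat_recr K) //=.
  have -> : \sum_l \sum_(0 <= k < K.+1) c k * spread (fun i => lam k i 0 l) =
    \sum_l \sum_(0 <= k < K) c k * spread (fun i => lam k i 0 l)
    + \sum_l c K * spread (fun i => lam K i 0 l).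
    by rewrite -big_split /=; apply: eq_bigr => l _; rewrite big_nat_recr.
  lra.
have WK : 0 <= W K by apply: sumr_ge0 => i _; apply: sumr_ge0 => l _; exact: sqr_ge0.
have h1 : m%:R * p%:R * L ^+ 2 * \sum_(0 <= k < K) c k ^+ 2 <= m%:R * p%:R * L ^+ 2 * Q.
  by rewrite ler_wpM2l // !mulr_ge0.
have h2 : 2 * m%:R * L * \sum_l \sum_(0 <= k < K) c k * spread (fun i => lam k i 0 l) <=
    2 * m%:R * L * \sum_l Cl l.
  by rewrite ler_wpM2l ?mulr_ge0 //; apply: ler_sum => l _; exact: HC.
lra.
Qed.

(** Jensen's inequality is applied to [f i] and to each component of [g i]; the latter keep their
    direction under multiplication by [mu l >= 0]. *)
Lemma average_gap_bounded : exists C, forall K,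
  (\sum_(0 <= r < K) c r) * \sum_i (lagrangian (xhat K i) - f (y i)) <= C.
Proof.
have [C HC] := weighted_gap_bounded; exists C => K; apply: le_trans (HC K).
rewrite mulr_sumr; under [leRHS]eq_bigr do rewrite mulr_sumr.
rewrite exchange_big /=; apply: ler_sum => i _.
have [fc gc _] := cvxA i.
have xS k : xhat k.+1 i = xhat k i
     + (c k / \sum_(0 <= r < k.+1) c r) *: (x k.+1 i - xhat k i).
  by have [] := algA.2 k i.
rewrite mulrBr; under [leRHS]eq_bigr do rewrite mulrBr.
rewrite sumrB -mulr_suml lerD2r /lagrangian mulrDr.
under [leRHS]eq_bigr do rewrite mulrDr.
rewrite big_split /=; apply: lerD.
  exact: (convex_running_average (x := fun k => x k i) (xhat := fun k => xhat k i) fc c_gt0 xS).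
rewrite mulr_sumr; under [leRHS]eq_bigr do rewrite mulr_sumr.
rewrite exchange_big /=; apply: ler_sum => l _.
have := ler_wpM2l (mu0 l) (convex_running_average
  (x := fun k => x k i) (xhat := fun k => xhat k i) (gc l) c_gt0 xS K).
rewrite mulr_sumr mulrCA; under [X in _ <= X -> _]eq_bigr do rewrite mulrCA.
by [].
Qed.
End Ergodic.
End Algorithm.

(** * Topology of row vectors *)

Lemma continuous_sumr (R : realType) (T : topologicalType) q (h : 'I_q -> T -> R) :
  (forall i, continuous (h i)) -> continuous (fun z => \sum_i h i z).
Proof. by move=> hc; apply: continuous_big => [|i _]; [exact: add_continuous | exact: hc]. Qed.

Lemma continuous_mull (R : realType) (T : topologicalType) (r : R) (h : T -> R) :
  continuous h -> continuous (fun z => r * h z).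
Proof. by move=> hc z; apply: cvgMl_tmp; exact: hc. Qed.

Lemma continuous_addr (R : realType) (T : topologicalType) (h1 h2 : T -> R) :
  continuous h1 -> continuous h2 -> continuous (fun z => h1 z + h2 z).
Proof. by move=> hc1 hc2 z; apply: cvgD; [exact: hc1 | exact: hc2]. Qed.

Section RowVectors.
Variable R : realType.

Lemma rV_norm_le d (h : 'rV[R]_d) (e : R) : 0 <= e ->
  (forall l, `|h 0 l| <= e) -> `|h| <= e.
Proof.
move=> e0 he; rewrite [leLHS]/Num.norm /= mx_normrE.
by apply: bigmax_le => // -[i l] _ /=; rewrite ord1.
Qed.

(** The crude factor [d] suffices to pass from sup-norm balls to Euclidean distances. *)
Lemma enorm_le_norm d (h : 'rV[R]_d) : enorm h <= d%:R * `|h|.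
Proof.
rewrite -(@ler_sqr _ (enorm h)) ?nnegrE ?sqrtr_ge0 ?mulr_ge0 //.
rewrite enorm_sqr; apply: (@le_trans _ _ (\sum_(l < d) `|h| ^+ 2)).
  apply: ler_sum => l _; rewrite -[_ 0 l ^+ 2]real_normK ?num_real //.
  by rewrite lerXn2r ?nnegrE // coord_le_norm.
rewrite sumr_const card_ord -[leLHS]mulr_natl exprMn ler_wpM2r ?sqr_ge0 //.
by rewrite -natrX ler_nat; case: d {h} => // d; rewrite expnS leq_pmulr // expn_gt0.
Qed.

Variables (m : nat) (n : 'I_m -> nat).

Lemma submxrow_norm_le (z : 'rV[R]_(\sum_i n i)) i : `|submxrow z i| <= `|z|.
Proof. by apply: rV_norm_le => // l; rewrite mxE coord_le_norm. Qed.

Lemma submxrow_continuous i :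
  continuous (fun z : 'rV[R]_(\sum_i n i) => submxrow z i : 'rV[R]_(n i)).
Proof.
move=> z; apply: (@cvgrPdist_le _ _ _ (nbhs z) _ _ (submxrow z i)).2 => e e0.
apply/nbhs_ballP; exists e => //= w; rewrite mx_norm_ball /ball_ /= => zw.
by rewrite -submxrowB (le_trans (submxrow_norm_le _ _)) // ltW.
Qed.

(** Boundedness is checked block by block, and closedness comes from an intersection of preimages
    under the block projections. *)
Lemma prod_set_compact (X : forall i, set 'rV[R]_(n i)) :
  (forall i, compact (X i)) -> compact (prod_set X).
Proof.
move=> cX; apply: bounded_closed_compact.
  have /choice[M HM] i : exists M : R, forall z, X i z -> `|z| <= M.
    have [M [_ HM]] := compact_bounded (@cX i).
    by exists (M + 1) => z; apply: HM; rewrite ltrDl.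
  exists (\sum_i `|M i|); split; first exact: num_real.
  move=> B MB z Xz; have B0 : 0 <= B by apply: le_trans (ltW MB); exact: sumr_ge0.
  apply: rV_norm_le => // s; rewrite -[z]submxrowK mxE.
  apply: le_trans (coord_le_norm _ _) _; apply: le_trans (HM _ _ (Xz _)) _.
  apply: le_trans (ler_norm _) _; apply: le_trans (ltW MB).
  by rewrite (bigD1 (tagnat.sig1 s)) //= lerDl sumr_ge0.
have -> : prod_set X = \bigcap_i ((fun z : 'rV[R]_(\sum_i n i) => submxrow z i) @^-1` X i).
  by apply/seteqP; split=> z Xz i; [move=> _; exact: Xz | exact: Xz].
apply: closed_bigI => i _; apply: closed_comp => [z _|]; first exact: submxrow_continuous.
by apply: compact_closed (@cX i); exact: norm_hausdorff.
Qed.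

End RowVectors.

(** * Distance to the minimizers and passage to cluster points *)

Lemma edist_set_ge0 (R : realType) d (y : 'rV[R]_d) Z : (0 <= edist_set y Z)%E.
Proof. by apply: le_ereal_inf_tmp => _ [z _ <-]; rewrite lee_fin sqrtr_ge0. Qed.

Lemma cvge0_le (R : realType) (u : nat -> \bar R) : (forall k, 0 <= u k)%E ->
  (forall e : R, 0 < e -> \forall k \near \oo, (u k <= e%:E)%E) ->
  (u k @[k --> \oo] --> (0 : \bar R))%E.
Proof.
move=> u0 ue; apply/fine_cvgP; split.
  apply: filterS (ue 1 ltr01) => k uk.
  by rewrite ge0_fin_numE // (le_lt_trans uk) // ltry.
apply/cvgrPdist_le => e e0; apply: filterS (ue e e0) => k uk /=.
have fin : u k \is a fin_num by rewrite ge0_fin_numE // (le_lt_trans uk) // ltry.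
by rewrite sub0r normrN ger0_norm ?fine_ge0 // -lee_fin fineK.
Qed.

Theorem theorem2 (R : realType) (m p : nat) (n : 'I_m -> nat)
    (X : forall i, set 'rV[R]_(n i))
    (f : forall i, 'rV[R]_(n i) -> R)
    (g : forall i, 'rV[R]_(n i) -> 'rV[R]_p)
    (a : nat -> 'I_m -> 'I_m -> R) (c : nat -> R)
    (x : nat -> forall i, 'rV[R]_(n i))
    (lam : nat -> 'I_m -> 'rV[R]_p)
    (xhat : nat -> forall i, 'rV[R]_(n i)) :
  convexity_assumption X f g ->
  compactness_assumption X ->
  slater_assumption X g ->
  coefficient_assumption c ->
  weights_assumption a ->
  connectivity_assumption a ->
  generated_by_algorithm X f g a c x lam xhat ->
  edist_set (\mxrow_i xhat k i) (primal_minimizers X f g) @[k --> \oo]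
    --> (0 : \bar R)%E.
Proof.
move=> cvxA cptA [y0 [Xy0 _] slater] coefA wA connA algA.
have gap := average_gap_bounded cvxA cptA coefA wA connA algA.
have Sdiv : series c @ \oo --> +oo by case: coefA.
pose u k : 'rV[R]_(\sum_i n i) := \mxrow_i xhat k i.
have uE k i : submxrow (u k) i = xhat k i by rewrite mxrowK.
have Xu k : prod_set X (u k).
  by move=> i; rewrite uE; exact: (xhat_mem cvxA coefA algA).
pose G := coupling g; pose F := total_cost f.
pose Phi (mu : 'I_p -> R) (z : 'rV[R]_(\sum_i n i)) := F z + \sum_l mu l * G z 0 l.
have feas0 : feasible X g y0.
  split=> // l; have [haff hnaff] := slater l.
  by have [/haff //|/hnaff /ltW] := pselect (affine_fun (fun z => coupling g z 0 l)).
have Phi_cont mu : continuous (Phi mu).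
  have FG : continuous F.
    apply: continuous_sumr => i z; have [fc _ _] := cvxA i.
    apply: (continuous_comp (f := fun z => submxrow z i) (g := f i)).
      exact: submxrow_continuous.
    exact: convex_continuous.
  have Gl l : continuous (fun z => \sum_i g i (submxrow z i) 0 l).
    apply: continuous_sumr => i z; have [_ gc _] := cvxA i.
    apply: (continuous_comp (f := fun z => submxrow z i) (g := fun w => g i w 0 l)).
      exact: submxrow_continuous.
    exact: convex_continuous (gc l) _.
  have Gc : continuous (fun z => \sum_l mu l * (\sum_i g i (submxrow z i) 0 l)).
    by apply: continuous_sumr => l; exact: continuous_mull.
  have -> : Phi mu = (fun z => F z + \sum_l mu l * (\sum_i g i (submxrow z i) 0 l)).
    apply/funext => z; congr (_ + _); apply: eq_bigr => l _.
    by rewrite /G /coupling summxE.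
  exact: continuous_addr.
have Phi_lim mu y d : (forall l, 0 <= mu l) -> feasible X g y -> 0 < d ->
    \forall k \near \oo, Phi mu (u k) <= F y + d.
  move=> mu0 [Xy gy] d0.
  have gy' l : \sum_i g i (submxrow y i) 0 l <= 0.
    by have := gy l; rewrite /coupling summxE.
  have [C HC] := gap _ mu Xy gy' mu0.
  have Sge := (cvgryPge (series c)).1 Sdiv.
  near=> k.
  (* The bound [C / d] beats the constant gap; the bound [1] makes the partial sum positive for the
     strict multiplication below. *)
  have Sk : Num.max 1 (C / d) <= series c k by near: k; exact: Sge.
  move: Sk; rewrite ge_max ler_pdivrMr // => /andP[S1 SC].
  have := HC k; rewrite -[\sum_(0 <= r < k) c r]/(series c k).
  have -> : \sum_i (lagrangian f g mu (xhat k i) - f i (submxrow y i)) = Phi mu (u k) - F y.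
    rewrite sumrB; congr (_ - _); rewrite /lagrangian big_split /=; congr (_ + _).
      by apply: eq_bigr => i _; rewrite uE.
    rewrite exchange_big; apply: eq_bigr => l _.
    rewrite -mulr_sumr; congr (_ * _); rewrite /G /coupling summxE.
    by apply: eq_bigr => i _; rewrite uE.
  move=> gapk; rewrite leNgt; apply/negP => big.
  have : series c k * d < series c k * (Phi mu (u k) - F y).
    by rewrite ltr_pM2l; lra.
  lra.
apply: cvge0_le => [k|e e0]; first exact: edist_set_ge0.
apply: contrapT => nbound.
have /choice[phi Hphi] N : exists k, (N <= k)%N /\
    ~ (edist_set (u k) (primal_minimizers X f g) <= e%:E)%E.
  apply: contrapT => none; apply: nbound; exists N => // k /= Nk.
  by apply: contrapT => h; apply: none; exists k.
have phi_inf : phi @ \oo --> \oo.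
  by apply/cvgnyPge => A; exists A => // N /= AN; apply: leq_trans AN (Hphi N).1.
have [z [Xz clz]] : prod_set X `&` cluster ((u \o phi) @ \oo) !=set0.
  apply: (prod_set_compact cptA); exists 0%N => // N _ /=; exact: Xu.
have Phi_z mu y : (forall l, 0 <= mu l) -> feasible X g y -> Phi mu z <= F y.
  move=> mu0 fy; rewrite leNgt; apply/negP => lt.
  (* [F y + d] is the midpoint: [Phi mu] is eventually at most this value along the iterates, yet
     exceeds it near the cluster point [z]. *)
  pose d := (Phi mu z - F y) / 2; have d0 : 0 < d by rewrite divr_gt0 ?subr_gt0.
  have [w [/= wle wlt]] : ([set w | Phi mu w <= F y + d] `&`
      [set w | F y + d < Phi mu w]) !=set0.
    apply: clz.
      exact: phi_inf (Phi_lim mu y d mu0 fy d0).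
    by apply: cvgr_gt (Phi_cont mu z) _ _; rewrite /d; lra.
  by move: wle; rewrite leNgt wlt.
have zopt : primal_minimizers X f g z.
  have F0 y : feasible X g y -> F z <= F y.
    move=> fy; have := Phi_z (fun=> 0) y (fun=> lexx 0) fy.
    by rewrite /Phi big1 ?addr0 // => l _; rewrite mul0r.
  split; last exact: F0; split=> // l; rewrite leNgt; apply/negP => Gl.
  (* This multiplier on a violated constraint makes [Phi] at [z] equal to [F y0 + 1]; its sign comes
     from [F0], proved first with the zero multiplier. *)
  pose t := (F y0 - F z + 1) / G z 0 l.
  have t0 : 0 <= t by rewrite divr_ge0 ?(ltW Gl) // addr_ge0 // subr_ge0 F0.
  have := Phi_z (fun j => if j == l then t else 0) y0.
  rewrite /Phi (bigD1 l) //= eqxx big1 => [|j /negPf ->]; last by rewrite mul0r.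
  rewrite divfK ?gt_eqF // addr0 => h.
  have : F z + (F y0 - F z + 1) <= F y0 by apply: h => // j; case: eqP.
  lra.
pose N := \sum_i n i.
have N1 : 0 < N%:R + 1 :> R by rewrite ltr_wpDl.
(* This sup-norm radius makes the Euclidean distance at most [e], even in dimension zero,
   contradicting the choice of [phi]. *)
have [w [[k _ wk] zw]] : (range (u \o phi) `&` ball z (e / (N%:R + 1))) !=set0.
  apply: clz; first by exists 0%N => // k _; exists k.
  by apply: nbhsx_ballx; rewrite divr_gt0.
apply: (Hphi k).2; apply: le_trans (_ : (enorm (w - z))%:E <= _)%E.
  by apply: ereal_inf_lbound; exists z => //; rewrite -wk.
rewrite lee_fin (le_trans (enorm_le_norm _)) //.
move: zw; rewrite mx_norm_ball /ball_ /= ltr_pdivlMr // distrC => zw.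
have := normr_ge0 (w - z); rewrite -/N; lra.
Unshelve. all: by end_near.
Qed.
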